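(* Let $P$ be a $2$-torsion free prime ring with identity $1$ that contains a nontrivial idempotent $e_1$, put $e_2=1-e_1$ and $P_{12}=e_1Pe_2$, and let $D:P\to P$ be a commuting Jordan left centralizer. If $[D(m)]_{12}=0$ for all $m\in P_{12}$, then $D$ is the zero map on $P$.
   Context: Rings are associative and not assumed commutative. A ring $P$ is prime if $p_1 P p_2 = 0$ implies $p_1=0$ or $p_2=0$; it is $2$-torsion free if $2p=0$ with $p\in P$ implies $p=0$. An idempotent $e_1$ ($e_1^2=e_1$) is nontrivial if $e_1\neq 0$ and $e_1\neq 1$. With $P_{ij}=e_iPe_j$ for $i,j\in\{1,2\}$, one has the Peirce decomposition $P=P_{11}+P_{12}+P_{21}+P_{22}$ (a direct sum of additive groups); for $x\in P$, $[x]_{ij}$ denotes the component $e_ixe_j$ of $x$ in $P_{ij}$. A commuting Jordan left centralizer on $P$ is an additive map $D:P\to P$ such that $D(p^2)=D(p)p$ and $D(p)p=pD(p)$ for all $p\in P$. *)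

(* Defs.v *)
From HB Require Import structures.
From mathcomp Require Import all_boot all_order all_algebra.

Set Implicit Arguments.
Unset Strict Implicit.
Unset Printing Implicit Defensive.

Import GRing.Theory.
Local Open Scope ring_scope.

Definition prime_ring (P : pzRingType) : Prop :=
  forall p1 p2 : P, (forall x : P, p1 * x * p2 = 0) -> p1 = 0 \/ p2 = 0.

Definition two_torsion_free (P : pzRingType) : Prop :=
  forall p : P, p *+ 2 = 0 -> p = 0.

Definition nontrivial_idempotent (P : pzRingType) (e : P) : Prop :=
  [/\ e ^+ 2 = e, e <> 0 & e <> 1].

(* [x]_ij is peirce_comp e_i e_j x. *)
Definition peirce_comp (P : pzRingType) (ei ej x : P) : P := ei * x * ej.

(* m lies in P_ij = e_i P e_j. *)
Definition in_peirce (P : pzRingType) (ei ej m : P) : Prop :=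
  exists x : P, m = peirce_comp ei ej x.

(* Additivity is carried by the type of D. *)
Definition commuting_jordan_left_centralizer (P : pzRingType)
    (D : {additive P -> P}) : Prop :=
  (forall p : P, D (p ^+ 2) = D p * p) /\ (forall p : P, D p * p = p * D p).

(* Main.v *)
Require Import Defs.
From HB Require Import structures.
From mathcomp Require Import all_boot all_order all_algebra.

(** In a ring with identity, a commuting Jordan left centralizer D is
    multiplication by a central element: comparing the two defining identities
    at p and at p + 1 shows that D p = c p and c p = p c, where c = D 1.
    The hypothesis on P_12 then says that c e_1 x e_2 = 0 for every x, because
    c is central and therefore passes through the Peirce projections.
    Primeness cancels e_2, which leaves c e_1 = 0; centrality turns this into
    c x e_1 = 0 for every x, and primeness cancels e_1, so c = 0. *)

Set Implicit Arguments.
Unset Strict Implicit.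
Unset Printing Implicit Defensive.

Import GRing.Theory.
Local Open Scope ring_scope.

(** The terms of D ((p + 1) ^+ 2) = D (p + 1) * (p + 1) that are linear in p
    read D p + D p = D p + D 1 * p. *)
Lemma jordan_left_centralizer_mull (P : pzRingType) (D : {additive P -> P}) :
  (forall p, D (p ^+ 2) = D p * p) -> forall p, D p = D 1 * p.
Proof.
move=> D_sq p; have := D_sq (p + 1).
rewrite expr2 !(mulrDl, mulrDr) !(mul1r, mulr1) !raddfD /= -expr2 D_sq mulrDl.
by move=> /addIr /addrI.
Qed.

(** The terms of D (p + 1) * (p + 1) = (p + 1) * D (p + 1) that are linear in p
    read D p + D 1 * p = D p + p * D 1. *)
Lemma commuting_image1_central (P : pzRingType) (D : {additive P -> P}) :
  (forall p, D p * p = p * D p) -> forall p, D 1 * p = p * D 1.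
Proof.
move=> D_comm p; have := D_comm (p + 1).
rewrite raddfD /= !(mulrDl, mulrDr) !(mul1r, mulr1) D_comm.
by rewrite !addrA => /addIr; rewrite -!addrA => /addrI; rewrite addrC => /addIr.
Qed.

(** The annihilator of a central element is a two-sided ideal, so c a = 0
    already gives c P a = 0. *)
Lemma prime_ring_central_eq0 (P : pzRingType) (c a : P) :
  prime_ring P -> (forall x, c * x = x * c) -> a <> 0 -> c * a = 0 -> c = 0.
Proof.
move=> P_prime c_central a_neq0 ca0.
by case: (P_prime c a) => // x; rewrite c_central -mulrA ca0 mulr0.
Qed.

Theorem theorem3p1 (P : pzRingType) (e1 e2 : P) (D : {additive P -> P})
    (P_2tf : two_torsion_free P) (P_prime : prime_ring P)
    (e1_idem : nontrivial_idempotent e1) (e2_def : e2 = 1 - e1)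
    (D_cjlc : commuting_jordan_left_centralizer D)
    (D12 : forall m : P, in_peirce e1 e2 m -> peirce_comp e1 e2 (D m) = 0) :
  forall p : P, D p = 0.
Proof.
case: D_cjlc => D_sq D_comm.
have D_mull := jordan_left_centralizer_mull D_sq.
have c_central := commuting_image1_central D_comm.
case: e1_idem => e1_sq e1_neq0 e1_neq1.
have e2_neq0 : e2 <> 0 by rewrite e2_def => /subr0_eq /esym.
have e2_sq : e2 * e2 = e2.
  by rewrite e2_def mulrBl mul1r mulrBr mulr1 -expr2 e1_sq subrr subr0.
have ce1_0 : D 1 * e1 = 0.
  case: (P_prime (D 1 * e1) e2) => // x.
  have := D12 _ (ex_intro _ x erefl); rewrite /peirce_comp D_mull.
  by rewrite mulrA -c_central -!mulrA e2_sq (mulrA e1 e1) -expr2 e1_sq.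
have c0 := prime_ring_central_eq0 P_prime c_central e1_neq0 ce1_0.
by move=> p; rewrite D_mull c0 mul0r.
Qed.
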